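(* Let $X_1,X_2$ be locally convex topological vector (LCTV) spaces, and let $\Omega_1\subset X_1$, $\Omega_2\subset X_2$ be nonempty compact convex sets. Assume that $f\colon X_1\times X_2\to\mathbb{R}$ is a continuous function that is concave-convex, i.e., (a) $f(\cdot,y)\colon X_1\to\mathbb{R}$ is concave for every fixed $y\in\Omega_2$; (b) $f(x,\cdot)\colon X_2\to\mathbb{R}$ is convex for every fixed $x\in\Omega_1$. Then we have the minimax equality $$\max_{x\in\Omega_1}\min_{y\in\Omega_2}f(x,y)=\min_{y\in\Omega_2}\max_{x\in\Omega_1}f(x,y).$$
   Context: All vector spaces are over $\mathbb{R}$, and LCTV spaces are assumed Hausdorff. Writing $\max$ and $\min$ means that the corresponding supremum and infimum are attained. *)

(* Defs.v *)
From mathcomp Require Import all_boot all_order all_algebra.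
From mathcomp Require Import all_classical all_reals.
From mathcomp Require Import interval_inference convex topology normedtype.

Set Implicit Arguments.
Unset Strict Implicit.
Unset Printing Implicit Defensive.

Import Order.TTheory GRing.Theory Num.Theory.
Import numFieldNormedType.Exports.

Local Open Scope classical_set_scope.
Local Open Scope ring_scope.
Local Open Scope convex_scope.

(* Same shape as the library's [convex_function], with the inequality
   reversed. *)
Definition concave_function (R : numFieldType) (E : lmodType R)
    (E' := convex_lmodType E) (D : set E') (f : E' -> R^o) :=
  forall t : {i01 R},
    {in D &, forall x y : E', f x <| t |> f y <= f (x <| t |> y)}.

(* The conjunct [has_sup A] (resp. [has_inf A]) is needed: the total functions
   [sup] and [inf] return 0 when the supremum or infimum does not exist, and
   that value may lie in [A]. *)
Definition sup_attained (R : realType) (A : set R) := has_sup A /\ A (sup A).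
Definition inf_attained (R : realType) (A : set R) := has_inf A /\ A (inf A).

(* Main.v *)
Require Import Defs.
From mathcomp Require Import all_boot all_order all_algebra.
From mathcomp Require Import all_classical all_reals.
From mathcomp Require Import unstable.
From mathcomp Require Import interval_inference convex topology normedtype.
From mathcomp Require Import derive ring lra.

(** The inequality max min <= min max is immediate, and the extrema are attained
    because a pointwise supremum of continuous functions is lower semicontinuous
    (lemmas [inf_sup_attained] and [sup_inf_attained]).  The content is the
    reverse inequality.

    Suppose alpha < beta lie strictly between max min and min max.  Each y in
    Omega2 then has some x in Omega1 with f (x, y) > beta, and compactness of
    Omega2 makes finitely many such x suffice ([compact_finite_select]).  It
    remains to merge finitely many points x into a single x0 in Omega1 with
    f (x0, y) >= alpha for all y in Omega2, since this contradicts
    max min < alpha.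

    Merging two points is a theorem of the alternative: if two convex functions
    are nowhere nonpositive simultaneously, then some convex combination of them
    is nonnegative everywhere ([convex_alternative]); this is separation of a
    convex set from the negative quadrant of the plane, done by hand by choosing
    the weight as a supremum of reals.  Concavity in x turns the combination of
    values into a value at a combination of points.  For more points
    ([finite_minimax]) one point x is set aside and the others are merged
    over the convex sublevel set where f (x, y) <= beta.  Every merge turns
    a strict inequality into a weak one, which is why a gap between alpha and
    beta is kept and halved at each stage. *)

Set Implicit Arguments.
Unset Strict Implicit.
Unset Printing Implicit Defensive.

Import Order.TTheory GRing.Theory Num.Theory.
Import numFieldNormedType.Exports.

Local Open Scope classical_set_scope.
Local Open Scope ring_scope.
Local Open Scope convex_scope.

(** * Theorem of the alternative and finite minimax *)

Lemma convex_set_sublevel (R : realType) (E : lmodType R) (B : set E)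
    (g : E -> R) (c : R) :
  convex_set B -> convex_function B g ->
  convex_set [set y | B y /\ g y <= c].
Proof.
move=> cB cg y z t /set_mem[By gy] /set_mem[Bz gz].
apply/mem_set; split; first by apply/set_mem/cB; exact/mem_set.
apply: (le_trans (cg t y z (mem_set By) (mem_set Bz))).
rewrite convRE; have t0 : 0 <= t%:num by []; have t1 : t%:num <= 1 by [].
by rewrite /onem /=; nra.
Qed.

(** Where g1 and g2 are both nonnegative any weight works.  A point b with
    g2 b < 0 bounds the weight t from below, a point a with g1 a < 0 bounds it
    from above, and in both cases the bound is the zero r of
    t |-> t * g1 + (1 - t) * g2.  The lower bounds lie below the upper ones: on
    the segment [a, b], at the point where the chord of g1 vanishes, convexity
    gives g1 <= 0, hence g2 > 0 there, so the chord of g2 is positive too. *)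
Lemma convex_alternative (R : realType) (E : lmodType R) (B : set E)
    (g1 g2 : E -> R) :
  convex_set B -> convex_function B g1 -> convex_function B g2 ->
  (forall y, B y -> 0 < g1 y \/ 0 < g2 y) ->
  exists t : {i01 R}, forall y, B y -> 0 <= (g1 y : R^o) <| t |> (g2 y : R^o).
Proof.
move=> cB cg1 cg2 pos.
have cross a b : B a -> B b -> g1 a < 0 -> g2 b < 0 ->
    g1 a * g2 b <= g2 a * g1 b.
  move=> Ba Bb a0 b0.
  have g1b : 0 < g1 b by case: (pos _ Bb) => //; rewrite ltNge ltW.
  (* The weight t below makes t * g1 a + (1 - t) * g1 b vanish. *)
  have d0 : 0 < g1 b - g1 a by lra.
  have t0 : 0 <= g1 b / (g1 b - g1 a) by apply: divr_ge0; lra.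
  have t1 : g1 b / (g1 b - g1 a) <= 1 by rewrite ler_pdivrMr//; lra.
  pose t := Itv01 t0 t1.
  have tE (u v : R) : (u : R^o) <| t |> (v : R^o) =
      (g1 b * u - g1 a * v) / (g1 b - g1 a).
    by rewrite convRE /= /onem; field; rewrite gt_eqF.
  have Bc : B ((a : convex_lmodType E) <| t |> b).
    by apply/set_mem/cB; exact/mem_set.
  have := cg1 t a b (mem_set Ba) (mem_set Bb).
  rewrite tE [g1 b * g1 a]mulrC subrr mul0r => g1c.
  have := cg2 t a b (mem_set Ba) (mem_set Bb).
  rewrite tE => g2c.
  have : 0 < (g1 b * g2 a - g1 a * g2 b) / (g1 b - g1 a).
    by apply: lt_le_trans g2c; case: (pos _ Bc) => //; rewrite ltNge g1c.
  by rewrite pmulr_lgt0 ?invr_gt0// => h; lra.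
pose r y := - g2 y / (g1 y - g2 y).
(* Adding 0 keeps S nonempty and its supremum nonnegative when g2 is nowhere
   negative. *)
pose S := [set s | s = 0 \/ exists2 b, B b /\ g2 b < 0 & s = r b].
have S0 : S 0 by left.
have S1 : ubound S 1.
  move=> _ [->|[b [Bb b0] ->]]; first exact: ler01.
  have g1b : 0 < g1 b by case: (pos _ Bb) => //; rewrite ltNge ltW.
  by rewrite /r ler_pdivrMr; lra.
have t0 : 0 <= sup S by apply: ub_le_sup => //; exists 1.
have t1 : sup S <= 1 by apply: ge_sup => //; exists 0.
exists (Itv01 t0 t1) => y By; rewrite convRE /= /onem.
have [y1|y1] := ltP (g1 y) 0; last have [y2|y2] := ltP (g2 y) 0.
- have g2y : 0 < g2 y by case: (pos _ By) => //; rewrite ltNge ltW.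
  have d0 : 0 < g2 y - g1 y by lra.
  suff : sup S <= g2 y / (g2 y - g1 y) by rewrite ler_pdivlMr// => h; lra.
  apply: ge_sup; first by exists 0.
  move=> _ [->|[b [Bb b0] ->]]; first by apply: divr_ge0; lra.
  have g1b : 0 < g1 b by case: (pos _ Bb) => //; rewrite ltNge ltW.
  have e0 : 0 < g1 b - g2 b by lra.
  rewrite /r ler_pdivrMr// mulrAC ler_pdivlMr//.
  by have := cross _ _ By Bb y1 b0; lra.
- have g1y : 0 < g1 y by case: (pos _ By) => //; rewrite ltNge ltW.
  have : r y <= sup S by apply: ub_le_sup; [exists 1|right; exists y].
  by rewrite /r ler_pdivrMr => [h|]; lra.
- by apply: addr_ge0; apply: mulr_ge0 => //; lra.
Qed.

(** Induction on s.  Where f x <= beta for the head x, the tail has a point that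
    exceeds beta, so the induction hypothesis on that sublevel set gives x' with
    f x' >= gamma there, gamma being the midpoint of alpha and beta.  Thus f x or
    f x' exceeds alpha everywhere on B, and the alternative gives the point
    between x and x'.  The set B shrinks along the induction, possibly to the
    empty set. *)
Lemma finite_minimax (R : realType) (E F : lmodType R)
    (A : set E) (B : set F) (f : E -> F -> R) (s : seq E) (alpha beta : R) :
  A !=set0 -> convex_set A -> convex_set B ->
  (forall y, B y -> concave_function A (f ^~ y)) ->
  (forall x, A x -> convex_function B (f x)) ->
  alpha < beta -> {in s, forall x, A x} ->
  (forall y, B y -> exists2 x, x \in s & beta < f x y) ->
  exists2 x0, A x0 & forall y, B y -> alpha <= f x0 y.
Proof.
move=> [a Aa] cA.
elim: s B alpha beta => [|x s IH] B alpha beta cB fA fB ab sA sB.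
  by exists a => // y /sB[].
have Ax : A x by apply: sA; rewrite mem_head.
pose B' := [set y | B y /\ f x y <= beta].
pose gamma := (alpha + beta) / 2.
have [|||||| x' Ax' fx'] := IH B' gamma beta.
- exact: convex_set_sublevel (fB _ Ax).
- by move=> y [By _]; exact: fA.
- move=> z Az t u v /set_mem[Bu _] /set_mem[Bv _].
  by apply: (fB _ Az); exact/mem_set.
- by rewrite /gamma; lra.
- by move=> z zs; apply: sA; rewrite inE zs orbT.
- move=> y [By fxy]; have [z] := sB _ By.
  by rewrite inE => /predU1P[->|zs fz]; [rewrite ltNge fxy|exists z].
have shift z : A z -> convex_function B (fun y => f z y - alpha).
  move=> Az t u v Bu Bv; have := fB _ Az t u v Bu Bv.
  by rewrite !convRE /onem /= => h; lra.
have [y By|t ht] := convex_alternative cB (shift _ Ax) (shift _ Ax').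
  have [fxy|fxy] := leP (f x y) beta; last by left; lra.
  by right; have := fx' _ (conj By fxy); rewrite /gamma; lra.
exists ((x : convex_lmodType E) <| t |> x').
  by apply/set_mem/cA; exact/mem_set.
move=> y By; have := fA _ By t x x' (mem_set Ax) (mem_set Ax').
apply: le_trans; have := ht _ By.
by rewrite !convRE /onem /= => h; lra.
Qed.

(** * Compactness *)

(** Finite index sequences directed by inclusion form a filter, along which
    being covered by the sequence holds eventually near each point of K; the
    near-covering form of compactness makes this hold uniformly on K. *)
Lemma compact_finite_select (T : topologicalType) (I : choiceType)
    (K : set T) (D : set I) (U : I -> set T) :
  compact K -> (forall i, D i -> open (U i)) ->
  (forall y, K y -> exists2 i, D i & U i y) ->
  exists2 s : seq I, {in s, forall i, D i} &
    forall y, K y -> exists2 i, i \in s & U i y.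
Proof.
move=> /compact_near_coveringP/near_covering_withinP Kc oU KU.
pose G := filter_from [set s : seq I | {in s, forall i, D i}]
  (fun s => [set s' : seq I | {in s', forall i, D i} /\ {subset s <= s'}]).
have PG : ProperFilter G.
  apply: filter_from_proper; last by move=> s sD; exists s; split.
  apply: filter_from_filter; first by exists [::].
  move=> s1 s2 D1 D2; exists (s1 ++ s2).
    by move=> i; rewrite mem_cat => /orP[/D1|/D2].
  move=> s [Ds ss]; split; split => // i si; apply: ss;
    by rewrite mem_cat si ?orbT.
have GD : G [set s : seq I | {in s, forall i, D i}] by exists [::] => // s [].
have [|s [Ds hs]] := @filter_ex _ G PG
    ([set s : seq I | {in s, forall i, D i}] `&`
     [set s : seq I | K `<=` [set y | exists2 i, i \in s & U i y]]).
  apply: filterI => //.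
  apply: (Kc _ G (fun s y => exists2 i, i \in s & U i y)) => y Ky.
  have [i Di Uiy] := KU _ Ky.
  exists (U i, [set s : seq I | {in s, forall i, D i} /\ {subset [:: i] <= s}]).
    split; first by apply: open_nbhs_nbhs; split=> //; exact: oU.
    by exists [:: i] => // j; rewrite inE => /eqP ->.
  move=> [y' s] /= [Uy' [_ si]] _; exists i => //.
  by apply: si; rewrite mem_head.
by exists s.
Qed.

(** The hard half of the minimax equality, read contrapositively: if min max
    exceeds beta, then max min is at least alpha for every alpha < beta. *)
Lemma compact_minimax (R : realType) (E : lmodType R)
    (F : preTopologicalLmodType R)
    (A : set E) (K : set F) (f : E -> F -> R) (alpha beta : R) :
  A !=set0 -> convex_set A -> compact K -> convex_set K ->
  (forall x, A x -> continuous (f x)) ->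
  (forall y, K y -> concave_function A (f ^~ y)) ->
  (forall x, A x -> convex_function K (f x)) ->
  alpha < beta ->
  (forall y, K y -> exists2 x, A x & beta < f x y) ->
  exists2 x0, A x0 & forall y, K y -> alpha <= f x0 y.
Proof.
move=> A0 cA cK convK fc fA fK ab hK.
have [|//|s sA hs] := @compact_finite_select F E K A
    (fun x => f x @^-1` [set r | beta < r]) cK.
  move=> x Ax; apply: open_comp; last exact: open_gt.
  by move=> y _; exact: fc.
exact: finite_minimax hs.
Qed.

(** * Attainment of extrema *)

Lemma inf_attained_lbound (R : realType) (A : set R) m :
  A m -> lbound A m -> inf_attained A.
Proof.
move=> Am mA; have iA : has_inf A by split; exists m.
have infE : inf A = m.
  apply/eqP; rewrite eq_le; apply/andP; split; first exact: ge_inf iA.2 _ Am.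
  exact: lb_le_inf iA.1 mA.
by rewrite /inf_attained infE.
Qed.

Lemma inf_attained_cont (R : realType) (T : topologicalType) (K : set T)
    (g : T -> R) :
  K !=set0 -> compact K -> continuous g -> inf_attained [set g y | y in K].
Proof.
move=> K0 cK cg.
have [|c /set_mem Kc cmin] := compact_EVT_min K0 cK (f := g).
  exact: continuous_subspaceT.
apply: (inf_attained_lbound (m := g c)); first by exists c.
by move=> _ [y Ky <-]; apply: cmin; exact/mem_set.
Qed.

(** A minimizer of the pointwise supremum G is any cluster point y0 of the
    almost-minimizing sets where G <= M + e, M being the infimum: each g i is at
    most M + e on a closed set containing such a set, hence at y0. *)
Lemma inf_sup_attained (R : realType) (T : topologicalType) (I : Type)
    (K : set T) (D : set I) (g : I -> T -> R) :
  K !=set0 -> compact K -> D !=set0 ->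
  (forall i, D i -> continuous (g i)) ->
  (forall y, K y -> has_ubound [set g i y | i in D]) ->
  inf_attained [set sup [set g i y | i in D] | y in K].
Proof.
move=> K0 cK [i0 Di0] cg ubg.
pose G y := sup [set g i y | i in D].
have leG i y : D i -> K y -> g i y <= G y.
  by move=> Di Ky; apply: ub_le_sup; [exact: ubg|exists i].
have [i0inf _] := inf_attained_cont K0 cK (cg _ Di0).
have iG : has_inf [set G y | y in K].
  split; first by case: K0 => y Ky; exists (G y); exists y.
  exists (inf [set g i0 y | y in K]) => _ [y Ky <-].
  apply: le_trans (leG _ _ Di0 Ky).
  by apply: ge_inf; [exact: i0inf.2|exists y].
pose M := inf [set G y | y in K].
pose H := filter_from [set e : R | 0 < e]
  (fun e => [set y | K y /\ G y <= M + e]).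
have PH : ProperFilter H.
  apply: filter_from_proper; last first.
    move=> e e0; have [_ [y Ky <-] Gy] := inf_adherent e0 iG.
    by exists y; split => //; exact: ltW.
  apply: filter_from_filter; first by exists 1; exact: ltr01.
  move=> e1 e2 e10 e20; exists (Num.min e1 e2); first by rewrite /= lt_min e10.
  move=> y [Ky Gy]; split; split => //; apply: (le_trans Gy);
    by rewrite lerD2l ge_min lexx ?orbT.
have [|y0 [Ky0 cl0]] := cK H PH; first by exists 1; [exact: ltr01|move=> y []].
have gy0 i : D i -> g i y0 <= M.
  move=> Di; apply/ler_addgt0Pr => e e0.
  have cl : closed (g i @^-1` [set r | r <= M + e]).
    by apply: closed_comp; [move=> y _; exact: cg|exact: closed_le].
  apply: cl => V nV; apply: cl0 => //.
  exists e => // y [Ky Gy]; exact: le_trans (leG _ _ Di Ky) Gy.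
apply: (inf_attained_lbound (m := G y0)); first by exists y0.
move=> _ [y Ky <-]; apply: (@le_trans _ _ M); last first.
  by apply: ge_inf; [exact: iG.2|exists y].
apply: ge_sup; first by exists (g i0 y0); exists i0.
by move=> _ [i Di <-]; exact: gy0.
Qed.

Lemma sup_attainedN (R : realType) (A : set R) :
  inf_attained (-%R @` A) -> sup_attained A.
Proof.
move=> [iA Am]; have AE : A = -%R @` (-%R @` A).
  rewrite image_comp (eq_imagel (f' := id)) ?image_id// => x _ /=.
  by rewrite opprK.
split; first by rewrite AE; apply/has_inf_supN.
by rewrite /inf -AE in Am; case: Am => x Ax /oppr_inj <-.
Qed.

Lemma sup_attained_cont (R : realType) (T : topologicalType) (K : set T)
    (g : T -> R) :
  K !=set0 -> compact K -> continuous g -> sup_attained [set g y | y in K].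
Proof.
move=> K0 cK cg; apply: sup_attainedN; rewrite image_comp.
by apply: inf_attained_cont => // y; apply: continuousN; exact: cg.
Qed.

Lemma sup_inf_attained (R : realType) (T : topologicalType) (I : Type)
    (K : set T) (D : set I) (g : I -> T -> R) :
  K !=set0 -> compact K -> D !=set0 ->
  (forall i, D i -> continuous (g i)) ->
  (forall y, K y -> has_lbound [set g i y | i in D]) ->
  sup_attained [set inf [set g i y | i in D] | y in K].
Proof.
move=> K0 cK D0 cg lbg; apply: sup_attainedN; rewrite image_comp.
rewrite (eq_imagel (f' := fun y => sup [set - g i y | i in D])); last first.
  by move=> y Ky; rewrite /= /inf opprK image_comp.
apply: (inf_sup_attained (g := fun i y => - g i y)) => //.
  by move=> i Di y; apply: continuousN; exact: cg.
move=> y /lbg[m hm]; exists (- m) => _ [i Di <-].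
by rewrite lerN2; apply: hm; exists i.
Qed.

Theorem corollary4p3 (R : realType) (X1 X2 : tvsType R)
    (hausX1 : hausdorff_space X1) (hausX2 : hausdorff_space X2)
    (Omega1 : set X1) (Omega2 : set X2)
    (Omega1_neq0 : Omega1 !=set0) (Omega2_neq0 : Omega2 !=set0)
    (Omega1_compact : compact Omega1) (Omega2_compact : compact Omega2)
    (Omega1_convex : convex_set Omega1) (Omega2_convex : convex_set Omega2)
    (f : X1 * X2 -> R) (f_cont : continuous f)
    (f_concave : forall y, Omega2 y ->
       concave_function [set: X1] (fun x => f (x, y)))
    (f_convex : forall x, Omega1 x ->
       convex_function [set: X2] (fun y => f (x, y))) :
  [/\ forall x, Omega1 x -> inf_attained [set f (x, y) | y in Omega2],
      sup_attained [set inf [set f (x, y) | y in Omega2] | x in Omega1],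
      forall y, Omega2 y -> sup_attained [set f (x, y) | x in Omega1],
      inf_attained [set sup [set f (x, y) | x in Omega1] | y in Omega2]
    & sup [set inf [set f (x, y) | y in Omega2] | x in Omega1] =
      inf [set sup [set f (x, y) | x in Omega1] | y in Omega2]].
Proof.
have f_contl y : continuous (fun x => f (x, y)).
  move=> x; apply: (cvg_comp _ _ (cvg_pair cvg_id (cvg_cst y))).
  exact: f_cont.
have f_contr x : continuous (fun y => f (x, y)).
  move=> y; apply: (cvg_comp _ _ (cvg_pair (cvg_cst x) cvg_id)).
  exact: f_cont.
have minA x : inf_attained [set f (x, y) | y in Omega2].
  exact: inf_attained_cont.
have maxA y : sup_attained [set f (x, y) | x in Omega1].
  exact: (sup_attained_cont (g := fun x => f (x, y))).
have maxminA :
    sup_attained [set inf [set f (x, y) | y in Omega2] | x in Omega1].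
  apply: (sup_inf_attained (g := fun y x => f (x, y))) => // x _.
  exact: (minA x).1.2.
have minmaxA :
    inf_attained [set sup [set f (x, y) | x in Omega1] | y in Omega2].
  apply: (inf_sup_attained (g := fun x y => f (x, y))) => // y _.
  exact: (maxA y).1.2.
split => //; apply/eqP; rewrite eq_le; apply/andP; split.
  have [x Ox <-] := maxminA.2; have [y Oy <-] := minmaxA.2.
  apply: (@le_trans _ _ (f (x, y))).
    by apply: ge_inf; [exact: (minA x).1.2|exists y].
  by apply: ub_le_sup; [exact: (maxA y).1.2|exists x].
rewrite leNgt; apply/negP.
set V := sup _; set M := inf _ => VM.
pose alpha := (2 * V + M) / 3; pose beta := (V + 2 * M) / 3.
have [|||||||||x0 Ox0 hx0] := @compact_minimax R X1 X2 Omega1 Omega2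
  (fun x y => f (x, y)) alpha beta; rewrite //.
- by move=> y Oy t u v _ _; apply: f_concave; rewrite ?in_setT.
- by move=> x Ox t u v _ _; apply: f_convex; rewrite ?in_setT.
- by rewrite /alpha /beta; lra.
- move=> y Oy; have [x Ox fxy] := (maxA y).2; exists x => //.
  rewrite fxy; apply: (@lt_le_trans _ _ M); first by rewrite /beta; lra.
  by apply: ge_inf; [exact: minmaxA.1.2|exists y].
suff : alpha <= V by rewrite /alpha; lra.
apply: (@le_trans _ _ (inf [set f (x0, y) | y in Omega2])).
  apply: lb_le_inf.
    by case: Omega2_neq0 => y Oy; exists (f (x0, y)); exists y.
  by move=> _ [y Oy <-]; exact: hx0.
by apply: ub_le_sup; [exact: maxminA.1.2|exists x0].
Qed.
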